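(* Let $\prec$ be any monomial ordering of $P(1)$ and extend it to a place $\mathbb N$-ordering of $P$, again denoted $\prec$. Let $\prec'$ be the graded monomial ordering of $F$ induced by $\prec$, i.e. $m\prec' n$ if and only if $\iota(m)\prec\iota(n)$, for all monomials $m,n$ of $F$. Then $\prec'$ is the graded right lexicographic order, that is, for any monomials $m=x_{i_1}\cdots x_{i_k}$, $n=x_{j_1}\cdots x_{j_l}$ of $F$ one has $m\prec' n$ if and only if $k<l$, or $k=l$, $i_s=j_s$ and $i_t<j_t$, for some $1\le t\le k$ and for all $t<s\le k$.
   Context: $K$ is a field, $X=\{x_1,x_2,\ldots\}$ a finite or countable set of variables, $F=K\langle X\rangle$ the free associative algebra, and $P=K[X\times\mathbb N^*]$ the commutative polynomial algebra in the variables $x_i(j)=(x_i,j)$, $i\ge1$, $j\in\mathbb N^*=\{1,2,\ldots\}$. $\iota:F\to P$ is the $K$-linear embedding with $x_{i_1}\cdots x_{i_d}\mapsto x_{i_1}(1)\cdots x_{i_d}(d)$ on monomials. A monomial ordering of a commutative polynomial algebra is a well-ordering of its monomials, compatible with multiplication, with $1\preceq m$ for all monomials $m$. A monomial ordering of $F$ is a well-ordering $\prec'$ of the monomials of $F$ such that $m\prec' n$ implies $umv\prec' unv$ for all monomials $m,n,u,v$; it is graded if $\deg(m)<\deg(n)$ implies $m\prec' n$. Let $P(j)=K[x_i(j)\mid i\ge1]$. Given a monomial ordering $\prec$ of $P(1)$, transport it to each $P(j)$ through the isomorphism $x_i(1)\mapsto x_i(j)$. The place $\mathbb N$-ordering of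 $P$ induced by it is the monomial ordering defined as follows: for monomials $m=m_{j_1}\cdots m_{j_k}$, $n=n_{j_1}\cdots n_{j_k}$ with $j_1>\cdots>j_k$ and $m_{j_s},n_{j_s}$ (possibly trivial) monomials of $P(j_s)$, $m$ is smaller than $n$ if and only if for some $1\le r\le k$ one has $m_{j_s}=n_{j_s}$ for all $1\le s<r$ and $m_{j_r}\prec n_{j_r}$. The ordering $\prec'$ of $F$ induced as in the claim by a place $\mathbb N$-ordering is a graded monomial ordering of $F$.
   Formalization: The index form i_t < j_t is proved assuming x_i(1) ≺ x_j(1) whenever i < j, since it fails e.g. if x_2(1) ≺ x_1(1); for an arbitrary monomial ordering of P(1) the result is proved with letters compared by ≺ instead of by index. *)

(* Defs.v *)
From HB Require Import structures.
From mathcomp Require Import all_boot all_order all_algebra.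
From mathcomp Require Import finmap.
From mathcomp.multinomials Require Export monalg.

Set Implicit Arguments.
Unset Strict Implicit.
Unset Printing Implicit Defensive.

Import GRing.Theory.

Local Open Scope ring_scope.

(* Commutative (resp. noncommutative) monomials over a set [I] of variables   *)
(* are [{cmonom I}] (resp. [{fmonom I}]); [ucm i] is the variable [i] seen as *)
(* a commutative monomial, [fdeg] the length of a word, and [<< m >>] a       *)
(* monomial seen as a polynomial.                                             *)

(* [N = Some n] gives X = {x_1, ..., x_n}; [N = None] gives X = {x_1, ...}.   *)
Definition is_index (N : option nat) (i : nat) : bool :=
  (0 < i)%N && (if N is Some n then (i <= n)%N else true).

Notation var N := {i : nat | is_index N i}.

Notation place := {j : nat | (0 < j)%N}.

(* The pair (x_i, j) is the variable x_i(j). *)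
Notation pvar N := (var N * place)%type.

Notation freealg K N := {malg K[{fmonom (var N)}]}.
Notation letterplace K N := {malg K[{cmonom (pvar N)}]}.

Definition nth_place (s : nat) : place := Sub s.+1 (ltn0Sn s).

(* The s-th letter, counted from 0, is sent to place s + 1. *)
Definition iota_monom (N : option nat) (m : {fmonom (var N)}) :
    {cmonom (pvar N)} :=
  \big[mmul/mone]_(s < size m) ucm (tnth (in_tuple m) s, nth_place s).

Definition letter_iota (K : fieldType) (N : option nat) (f : freealg K N) :
    letterplace K N :=
  \sum_(m <- msupp f) f@_m *: << iota_monom m >>.

Lemma letter_iotaE (K : fieldType) (N : option nat) :
  @letter_iota K N =1 mmap malgC (fun m => << iota_monom m >>).
Proof. by move=> f; apply: eq_bigr => m _; rewrite mul_malgC. Qed.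

Fact letter_iota_is_linear (K : fieldType) (N : option nat) : linear (@letter_iota K N).
Proof.
move=> a f g; rewrite !letter_iotaE raddfD /=; congr (_ + _).
rewrite (mmapEw (msuppZ_le _ _)) -letter_iotaE /letter_iota scaler_sumr.
by apply: eq_bigr => m _; rewrite mcoeffZ scalerA mul_malgC.
Qed.

HB.instance Definition _ (K : fieldType) (N : option nat) :=
  GRing.isLinear.Build K (freealg K N) (letterplace K N) *:%R (@letter_iota K N)
    (@letter_iota_is_linear K N).

Lemma letter_iotaU (K : fieldType) (N : option nat) (m : {fmonom (var N)}) :
  @letter_iota K N << m >> = << iota_monom m >>.
Proof. by rewrite letter_iotaE mmapU mul_malgC scale1r. Qed.

(* Orderings are given by their strict part. *)
Definition well_ordering (T : Type) (lt : T -> T -> Prop) : Prop :=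
  [/\ forall x y z, lt x y -> lt y z -> lt x z,
      forall x y, [\/ lt x y, x = y | lt y x]
    & well_founded lt].

Definition monomial_ordering (M : conomType) (lt : M -> M -> Prop) : Prop :=
  [/\ well_ordering lt,
      forall u m n, lt m n -> lt (mmul u m) (mmul u n)
    & forall m, mone = m \/ lt mone m].

(* Monomials of P(j) are encoded as [{cmonom (var N)}] for every j, through   *)
(* x_i <-> x_i(j), so that one relation on [{cmonom (var N)}] is both an      *)
(* ordering of P(1) and its transports to all the P(j). [at_place j] is the   *)
(* inclusion of the monomials of P(j) into those of P.                        *)
Definition at_place (N : option nat) (j : place) (u : {cmonom (var N)}) :
    {cmonom (pvar N)} :=
  \big[mmul/mone]_(x <- finsupp u) expcmn (ucm (x, j)) (u x).

Definition place_ordering (N : option nat)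
    (lt : {cmonom (var N)} -> {cmonom (var N)} -> Prop)
    (m n : {cmonom (pvar N)}) : Prop :=
  exists (k : nat) (j : 'I_k -> place) (mj nj : 'I_k -> {cmonom (var N)}),
    [/\ forall s t : 'I_k, (s < t)%N -> (val (j t) < val (j s))%N,
        m = \big[mmul/mone]_(s < k) at_place (j s) (mj s),
        n = \big[mmul/mone]_(s < k) at_place (j s) (nj s)
      & exists r : 'I_k,
          (forall s : 'I_k, (s < r)%N -> mj s = nj s) /\ lt (mj r) (nj r)].

Definition induced_ordering (K : fieldType) (N : option nat)
    (lt : {cmonom (pvar N)} -> {cmonom (pvar N)} -> Prop)
    (m n : {fmonom (var N)}) : Prop :=
  exists u v : {cmonom (pvar N)},
    [/\ letter_iota << m >> = << u >> :> letterplace K N,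
        letter_iota << n >> = << v >> :> letterplace K N
      & lt u v].

(* The graded right lexicographic order of words for a given strict order     *)
(* [ltx] of the letters.                                                      *)
Definition graded_right_lex (N : option nat) (ltx : var N -> var N -> Prop)
    (m n : {fmonom (var N)}) : Prop :=
  (fdeg m < fdeg n)%N \/
  exists (k : nat) (i j : k.-tuple (var N)),
    [/\ m = i :> seq (var N), n = j :> seq (var N)
      & exists t : 'I_k, ltx (tnth i t) (tnth j t) /\
          forall s : 'I_k, (t < s)%N -> tnth i s = tnth j s].

(* Main.v *)
Require Import Defs.
From mathcomp Require Import all_boot all_order all_algebra.
From mathcomp Require Import finmap zify.

Set Implicit Arguments.
Unset Strict Implicit.
Unset Printing Implicit Defensive.

(** A place ordering compares two monomials of P at the highest place where
    they differ.  Its definition, by a common decreasing list of places, is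
    equivalent to this description ([place_orderingP]): the components of a
    product over distinct places are its factors, and conversely two monomials
    only involve places up to a common bound k, so the list k, k - 1, ..., 1
    serves both.

    The embedding of a word w has one letter at each place up to the length of
    w and the trivial component 1 at all later places ([component_iota]).  Since
    1 is the least monomial and is never a variable, two words of different
    lengths differ, from the highest place down, first at the last letter of the
    longer one, where the shorter one has 1: the shorter word is smaller.  Words
    of equal length are compared at the last position where they differ, through
    the order of the variables of P(1).  This is the graded right lexicographic order
    ([graded_right_lexP]).  When the order of the variables is that of their
    indices, totality turns the one implication assumed into an equivalence. *)

Section CommutativeMonomials.
Context (I : choiceType).
Implicit Types (m : {cmonom I}) (x : I).

Lemma cm_big (J : Type) (r : seq J) (F : J -> {cmonom I}) x :
  (\big[mmul/mone]_(i <- r) F i) x = \sum_(i <- r) F i x.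
Proof.
exact: (big_morph (fun m : {cmonom I} => m x) (cmM x) (cm1 x)).
Qed.

Lemma expcmnE m n x : expcmn m n x = n * m x.
Proof.
case: n => [|n]; first by rewrite mul0n; exact: cm1.
rewrite /expcmn iteropS; elim: n => [|n IHn] /=; first by rewrite mul1n.
by rewrite mulcmE IHn mulSn.
Qed.

Lemma ucm_inj : injective (@ucm I).
Proof.
move=> x y /eqP/cmP/(_ x); rewrite cmUU cmU.
by case: (y =P x) => // ->.
Qed.

End CommutativeMonomials.

Lemma mkmalgU_inj (T : choiceType) (G : zmodType) (c : G) :
  c != 0%R -> injective (fun k : T => mkmalgU k c).
Proof.
move=> c0 k l /(congr1 (mcoeff k)) /eqP; rewrite mcoeffUU mcoeffU.
by case: (l =P k) => // _; rewrite GRing.mulr0n (negbTE c0).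
Qed.


Section WellOrdering.
Context (T : Type) (lt : T -> T -> Prop) (lt_wo : well_ordering lt).

Lemma well_ordering_irr x : ~ lt x x.
Proof.
case: lt_wo => _ _ wf; elim/(well_founded_ind wf): x => x IHx xx.
exact: (IHx x xx xx).
Qed.

Lemma well_ordering_asym x y : lt x y -> ~ lt y x.
Proof. by case: lt_wo => tr _ _ xy /(tr _ _ _ xy)/well_ordering_irr. Qed.

End WellOrdering.

Section Places.
Context (N : option nat).
Implicit Types (m n : {cmonom (pvar N)}) (p q : place) (x : var N).

(** The factor of [m] in P(p), read as a monomial in the x_i.  The finite set
    only bounds the support: outside it the exponents vanish anyway
    ([componentE]). *)
Definition component p m : {cmonom (var N)} :=
  [cmonom m (x, p) | x in [fset y.1 | y in finsupp m]%fset]%M.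

Lemma componentE p m x : component p m x = m (x, p).
Proof.
rewrite cmE fsfun_fun; case: ifP => // /negbT xNm.
apply/esym/eqP; rewrite cmE_eq0; apply: contra xNm => xpm.
by apply/imfsetP; exists (x, p).
Qed.

Lemma at_placeE p u x q : at_place p u (x, q) = if p == q then u x else 0.
Proof.
rewrite /at_place cm_big.
under eq_bigr => y _ do rewrite expcmnE cmU xpair_eqE.
case: (p == q); last by rewrite big1 // => y _; rewrite andbF muln0.
have other y : y != x -> u y * ((y == x) && true) = 0.
  by move=> /negbTE->; rewrite muln0.
case: (finsuppP u x) => xu.
  by rewrite big_seq big1 // => y yu; apply: other; apply: contraNneq xu => <-.
rewrite (big_fsetD1 x) //= eqxx muln1 big_seq big1 ?addn0 // => y.
by rewrite in_fsetD1 => /andP[+ _]; exact: other.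
Qed.

Lemma component_place_prod k (j : 'I_k -> place)
    (u : 'I_k -> {cmonom (var N)}) s :
    injective j ->
  component (j s) (\big[mmul/mone]_(t < k) at_place (j t) (u t)) = u s.
Proof.
move=> j_inj; apply/eqP/cmP => x; rewrite componentE cm_big.
under eq_bigr => t _ do rewrite at_placeE (inj_eq j_inj).
by rewrite -big_mkcond big_pred1_eq.
Qed.

Lemma component_place_prod_out k (j : 'I_k -> place)
    (u : 'I_k -> {cmonom (var N)}) q :
    (forall s, j s != q) ->
  component q (\big[mmul/mone]_(t < k) at_place (j t) (u t)) = mone.
Proof.
move=> jNq; apply/eqP/cmP => x; rewrite componentE cm_big cm1 big1 // => t _.
by rewrite at_placeE (negbTE (jNq t)).
Qed.

Lemma placeP p : exists s, p = nth_place s.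
Proof. by exists (val p).-1; apply: val_inj; rewrite /= prednK // (valP p). Qed.

Lemma nth_place_eq s t : (nth_place s == nth_place t) = (s == t).
Proof. by rewrite -val_eqE /= eqSS. Qed.

Lemma place_bound m : exists k, forall x s, k <= s -> m (x, nth_place s) = 0.
Proof.
exists (\max_(y <- finsupp m) val y.2) => x s ks.
apply/eqP; rewrite cmE_eq0; apply/negP => xsm.
move: ks; rewrite leqNgt => /negP; apply.
exact: (@leq_bigmax_seq _ _ xpredT (fun y : pvar N => val y.2) _ xsm isT).
Qed.

(** Places are listed from k down to 1, because a place ordering requires a
    decreasing list: position [s] of the list holds place k - s, that is
    [nth_place] of [rev_ord s]. *)
Lemma place_decomposition k m :
    (forall x s, k <= s -> m (x, nth_place s) = 0) ->
  m = \big[mmul/mone]_(s < k)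
        at_place (nth_place (rev_ord s)) (component (nth_place (rev_ord s)) m).
Proof.
move=> m0; apply/eqP/cmP => -[x p]; have [s ->] := placeP p; rewrite cm_big.
under eq_bigr => t _ do rewrite at_placeE componentE nth_place_eq.
case: (ltnP s k) => [sk|ks]; last first.
  rewrite m0 // big1 // => t _; case: eqP => //= ts.
  by have := ltn_ord t; lia.
rewrite (bigD1 (rev_ord (Ordinal sk))) //= subnSK // subKn ?(ltnW sk) //.
rewrite eqxx big1 ?addn0 // => t /eqP tNs.
by case: eqP => // ts; case: tNs; apply: val_inj => /=; have := ltn_ord t; lia.
Qed.

(** The list of places in the definition of a place ordering is arbitrary; this
    removes it.  Places outside a given list carry trivial components on both
    sides, so they never separate the two monomials. *)
Lemma place_orderingP lt m n :
  place_ordering lt m n <->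
  exists s, lt (component (nth_place s) m) (component (nth_place s) n) /\
    forall t, s < t -> component (nth_place t) m = component (nth_place t) n.
Proof.
split=> [[k [j [u [v [j_decr -> -> [r [uv_eq uv_lt]]]]]]]|[s [mn_lt mn_eq]]].
  have j_inj : injective j.
    move=> s t /(congr1 val) e; apply: val_inj.
    by case: (ltngtP s t) => // /j_decr; rewrite e ltnn.
  have [p jr] := placeP (j r).
  exists p; rewrite -jr !component_place_prod //; split=> // q pq.
  case: (pickP (fun s => j s == nth_place q)) => [s /eqP jsq | jNq].
    rewrite -jsq !component_place_prod //; apply: uv_eq.
    case: (ltngtP s r) => // [/j_decr|/val_inj sr].
      by rewrite jr jsq /= ltnS ltnNge (ltnW pq).
    by move/(congr1 val): jsq; rewrite sr jr => -[e]; rewrite e ltnn in pq.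
  by rewrite !component_place_prod_out // => s; rewrite jNq.
have [[km m0] [kn n0]] := (place_bound m, place_bound n).
(* The separating place has to be in the list as well, whence s.+1. *)
pose k := maxn s.+1 (maxn km kn).
have sk : s < k by lia.
exists k, (fun t => nth_place (rev_ord t)),
  (fun t => component (nth_place (rev_ord t)) m),
  (fun t => component (nth_place (rev_ord t)) n).
split=> /=.
- by move=> t t' tt'; have := ltn_ord t'; lia.
- by apply: place_decomposition => x t kt; apply: m0; lia.
- by apply: place_decomposition => x t kt; apply: n0; lia.
exists (rev_ord (Ordinal sk)) => /=; split=> [t ts|].
  by apply: mn_eq; have := ltn_ord t; lia.
by rewrite subnSK // subKn ?(ltnW sk).
Qed.

End Places.

Section Words.
Context (N : option nat).
Implicit Types (m n : {fmonom (var N)}).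

(** Padding words with the monomial 1 lets words of different lengths be
    compared position by position, exactly as their images in P are. *)
Definition letter_monom (w : seq (var N)) (s : nat) : {cmonom (var N)} :=
  oapp (@ucm (var N)) mone (onth w s).

Lemma letter_monom_default w s : size w <= s -> letter_monom w s = mone.
Proof. by move=> ws; rewrite /letter_monom onth_default. Qed.

Lemma letter_monom_tnth k (w : k.-tuple (var N)) (s : 'I_k) :
  letter_monom w s = ucm (tnth w s).
Proof. by rewrite /letter_monom ((tnth_onth _ w s).1 erefl). Qed.

Lemma letter_monom_eq1 w s : letter_monom w s = mone <-> size w <= s.
Proof.
split=> [|/letter_monom_default//].
rewrite -onthNE /letter_monom; case: onth => //= x /eqP.
by rewrite cm1_eq1.
Qed.

Lemma component_iota m s :
  component (nth_place s) (iota_monom m) = letter_monom m s.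
Proof.
apply/eqP/cmP => x; rewrite componentE /iota_monom cm_big.
under eq_bigr => t _ do rewrite cmU xpair_eqE nth_place_eq.
case: (ltnP s (size m)) => [sm|ms]; last first.
  rewrite letter_monom_default // cm1 big1 // => t _.
  by case: (_ =P s) => [ts|]; [have := ltn_ord t; lia | rewrite andbF].
rewrite (bigD1 (Ordinal sm)) //= eqxx andbT.
rewrite (letter_monom_tnth (in_tuple m) (Ordinal sm)) cmU.
rewrite big1 ?addn0 // => t.
by rewrite -val_eqE => /negbTE /= ->; rewrite andbF.
Qed.

Lemma induced_orderingP (K : fieldType) lt m n :
  induced_ordering K lt m n <-> lt (iota_monom m) (iota_monom n).
Proof.
split=> [[u [v []]]|mn]; last first.
  by exists (iota_monom m), (iota_monom n); rewrite !letter_iotaU.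
rewrite !letter_iotaU => /(mkmalgU_inj (@GRing.oner_neq0 K))->.
by move=> /(mkmalgU_inj (@GRing.oner_neq0 K))->.
Qed.

(** The padding is what makes the order graded: 1 is smaller than every letter,
    so the last letter of the longer word decides against the shorter one. *)
Lemma graded_right_lexP lt m n : monomial_ordering lt ->
  (exists s, lt (letter_monom m s) (letter_monom n s) /\
    forall t, s < t -> letter_monom m t = letter_monom n t) <->
  graded_right_lex (fun x y : var N => lt (ucm x) (ucm y)) m n.
Proof.
case=> lt_wo _ lt1.
have ltN1 u : ~ lt u mone.
  case: (lt1 u) => [<-|]; first exact: well_ordering_irr.
  exact: well_ordering_asym.
split=> [[s [mn_lt mn_eq]]|[]].
- have sn : s < size n.
    rewrite ltnNge; apply/negP => ns; move: mn_lt.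
    by rewrite (letter_monom_default ns) => /ltN1.
  case: (ltnP (size m) (size n)) => [|nm]; first by left.
  (* Position size n lies beyond s, so m carries 1 there, as n does. *)
  have {}nm : size n = size m.
    apply/eqP; rewrite eqn_leq nm; apply/letter_monom_eq1.
    by rewrite mn_eq // letter_monom_default.
  right; exists (size m), (in_tuple m), (tcast nm (in_tuple n)).
  split=> //; first by rewrite val_tcast.
  have sm : s < size m by rewrite -nm.
  have E (t : 'I_(size m)) :
      ucm (tnth (tcast nm (in_tuple n)) t) = letter_monom n t.
    by rewrite -letter_monom_tnth val_tcast.
  exists (Ordinal sm); split=> [|t st].
    by rewrite E -letter_monom_tnth.
  by apply: (@ucm_inj (var N)); rewrite E -letter_monom_tnth mn_eq.
(* The last letter of the longer word separates it from the shorter one. *)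
- rewrite /fdeg; case nk: (size n) => [//|k]; rewrite ltnS => mk.
  exists k; split=> [|t kt]; last first.
    by rewrite !letter_monom_default ?nk // (leq_trans mk (ltnW kt)).
  rewrite (letter_monom_default mk).
  case: (lt1 (letter_monom n k)) => // /esym/letter_monom_eq1.
  by rewrite nk ltnn.
case=> k [i [j [mi nj [t [ij_lt ij_eq]]]]]; exists t.
rewrite mi nj !letter_monom_tnth; split=> // s ts.
case: (ltnP s k) => [sk|ks]; last by rewrite !letter_monom_default ?size_tuple.
by rewrite -[s]/(val (Ordinal sk)) !letter_monom_tnth ij_eq.
Qed.

Lemma graded_right_lex_ext (ltx ltx' : var N -> var N -> Prop) m n :
    (forall x y, ltx x y <-> ltx' x y) ->
  graded_right_lex ltx m n <-> graded_right_lex ltx' m n.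
Proof.
move=> e; split=> -[mn|]; do ?[by left].
all: case=> k [i [j [mi nj [t [/e ij ij_eq]]]]].
all: by right; exists k, i, j; split=> //; exists t.
Qed.

End Words.

Theorem corollary4p8 (K : fieldType) (N : option nat)
    (lt : {cmonom (var N)} -> {cmonom (var N)} -> Prop)
    (lt_mon : monomial_ordering lt) :
  (forall m n : {fmonom (var N)},
     induced_ordering K (place_ordering lt) m n <->
     graded_right_lex (fun x y : var N => lt (ucm x) (ucm y)) m n) /\
  ((forall x y : var N, (val x < val y)%N -> lt (ucm x) (ucm y)) ->
   forall m n : {fmonom (var N)},
     induced_ordering K (place_ordering lt) m n <->
     graded_right_lex (fun x y : var N => (val x < val y)%N) m n).
Proof.
have main (m n : {fmonom (var N)}) :
    induced_ordering K (place_ordering lt) m n <->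
    graded_right_lex (fun x y : var N => lt (ucm x) (ucm y)) m n.
  rewrite induced_orderingP place_orderingP -(graded_right_lexP _ _ lt_mon).
  by split=> -[s [mn_lt mn_eq]]; exists s; move: mn_lt; rewrite !component_iota;
     split=> // t /mn_eq; rewrite !component_iota.
split=> // lt_val m n; rewrite main; apply: graded_right_lex_ext => x y.
split=> [xy|/lt_val//]; case: lt_mon => lt_wo _ _.
case: (ltngtP (val x) (val y)) => // [/lt_val|/val_inj e].
  by move/(well_ordering_asym lt_wo).
by rewrite e in xy; case: (well_ordering_irr lt_wo xy).
Qed.
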